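(* Let $K\in\mathcal L(\mathcal H)$ and let $\mathcal W=\{(W_i,w_i)\}_{i\in I}$ be a $K$-fusion frame for $\mathcal H$ with bounds $A$ and $B$. Suppose that $\{V_i\}_{i\in I}$ is a family of closed subspaces of $\mathcal H$ and there exist constants $\lambda_1,\lambda_2,\mu\ge0$ such that $\max\{\lambda_1+\frac{\mu}{\sqrt A},\lambda_2\}<1$ and $$\bigg(\sum_{i\in I}w_i^2\|(\pi_{W_i}-\pi_{V_i})f\|^2\bigg)^{1/2}\le\lambda_1\bigg(\sum_{i\in I}w_i^2\|\pi_{W_i}f\|^2\bigg)^{1/2}+\lambda_2\bigg(\sum_{i\in I}w_i^2\|\pi_{V_i}f\|^2\bigg)^{1/2}+\mu\|K^*f\|$$ for all $f\in\mathcal H$. Then $\{(V_i,w_i)\}_{i\in I}$ is a $K$-fusion frame for $\mathcal H$ with (lower and upper) bounds $$A\bigg(1-\frac{\lambda_1+\lambda_2+\frac{\mu}{\sqrt A}}{1+\lambda_2}\bigg)^2\quad\text{and}\quad B\bigg(1+\frac{\lambda_1+\lambda_2+\frac{\mu}{\sqrt A}}{1-\lambda_2}\bigg)^2.$$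
   Context: $\mathcal H$ is a separable Hilbert space, $\mathcal L(\mathcal H)$ is the space of bounded linear operators on $\mathcal H$, and $I$ is a countable index set. For a closed subspace $W$, $\pi_W$ denotes the orthogonal projection onto $W$. Let $\{W_i\}_{i\in I}$ be a sequence of closed subspaces of $\mathcal H$, $\{w_i\}_{i\in I}$ a family of weights ($w_i>0$ for all $i$), and $K\in\mathcal L(\mathcal H)$. Then $\{(W_i,w_i)\}_{i\in I}$ is a $K$-fusion frame for $\mathcal H$ with bounds $A$ (lower) and $B$ (upper), $0<A\le B<\infty$, if $A\|K^*f\|^2\le\sum_{i\in I}w_i^2\|\pi_{W_i}(f)\|^2\le B\|f\|^2$ for all $f\in\mathcal H$.
   Formalization: The formal theorem additionally assumes that the series of w_i^2‖π_{V_i}f‖^2 converges for every f, so that the inequality is between real numbers; if both sides may be infinite the claim is false (W_0=H, W_i=0 for i>0, V_i=H for all i, w_i=1, K=id, λ_2=1/2). *)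

(* Defs.v *)
From mathcomp Require Import all_boot all_order all_algebra.
From mathcomp Require Import sesquilinear complex.
From mathcomp Require Import all_classical all_reals all_analysis.

Set Implicit Arguments.
Unset Strict Implicit.
Unset Printing Implicit Defensive.

Import Order.TTheory GRing.Theory Num.Theory.
Import numFieldNormedType.Exports.

Local Open Scope classical_set_scope.
Local Open Scope ring_scope.

(* Hilbert spaces are taken over the real or the complex numbers; the scalar
   field is a parameter so that one statement covers both cases. *)
Variant scalar_kind := RealScalars | ComplexScalars.

Definition scalar_field (R : realType) (k : scalar_kind) : numFieldType :=
  match k with
  | RealScalars => R
  | ComplexScalars => R[i]
  end.

Definition conj_scalar (R : realType) (k : scalar_kind) :
    {rmorphism scalar_field R k -> scalar_field R k} :=
  match k with
  | RealScalars => idfun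
  | ComplexScalars => @conjc R
  end.
Arguments conj_scalar : clear implicits.

Definition re_scalar (R : realType) (k : scalar_kind) : scalar_field R k -> R :=
  match k with
  | RealScalars => idfun
  | ComplexScalars => @complex.Re R
  end.

(* A Hilbert space is a complete normed module whose norm comes from an inner
   product, linear in its first argument and conjugate-linear in the second. *)
Definition inner_product_of_norm (R : realType) (k : scalar_kind)
    (H : completeNormedModType (scalar_field R k))
    (dot : {dot H for conj_scalar R k}) : Prop :=
  forall x : H, dot x x = `|x| ^+ 2.

Definition separable_space (T : topologicalType) : Prop :=
  exists2 D : set T, countable D & dense D.

Section Hilbert.
Context (R : realType) (k : scalar_kind).
Context (H : completeNormedModType (scalar_field R k)).
Context (dot : {dot H for conj_scalar R k}).

(* The norm of H takes its values in the scalar field, as nonnegative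
   elements; this is the same norm with values in R. *)
Definition rnorm (x : H) : R := re_scalar `|x|.

Definition bounded_operator (K : {linear H -> H}) : Prop :=
  exists M : R, forall f : H, rnorm (K f) <= M * rnorm f.

Definition closed_subspace (W : set H) : Prop :=
  [/\ closed W, W 0 &
      forall (a : scalar_field R k) (x y : H), W x -> W y -> W (a *: x + y)].

(* The value at f of the orthogonal projection onto W: the unique p in W with
   f - p orthogonal to W. It exists for every closed subspace W; the default
   value 0 is only used for other sets. *)
Definition orthogonal_projection (W : set H) (f : H) : H :=
  xget 0 [set p | W p /\ forall g, W g -> dot (f - p) g = 0].

(* The value at f of the Hilbert adjoint of K. It exists for every bounded K;
   the default value 0 is only used for unbounded operators. *)
Definition adjoint (K : {linear H -> H}) (f : H) : H :=
  xget 0 [set g | forall x, dot (K x) f = dot x g].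

Context (I : countType).

Definition weighted_square_sum (w : I -> R) (u : I -> H) : \bar R :=
  (\esum_(i in [set: I]) (w i ^+ 2 * rnorm (u i) ^+ 2)%:E)%E.

Definition K_fusion_frame (K : {linear H -> H}) (W : I -> set H) (w : I -> R)
    (A B : R) : Prop :=
  [/\ forall i, closed_subspace (W i),
      forall i, 0 < w i,
      0 < A <= B &
      forall f : H,
        let S := weighted_square_sum w
                   (fun i => orthogonal_projection (W i) f) in
        ((A * rnorm (adjoint K f) ^+ 2)%:E <= S)%E /\
        (S <= (B * rnorm f ^+ 2)%:E)%E].

End Hilbert.

(* Main.v *)
Require Import Defs.
From mathcomp Require Import all_boot all_order all_algebra.
From mathcomp Require Import sesquilinear complex.
From mathcomp Require Import all_classical all_reals all_analysis.
From mathcomp Require Import ring lra.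

Set Implicit Arguments.
Unset Strict Implicit.
Unset Printing Implicit Defensive.

Import Order.TTheory GRing.Theory Num.Theory.
Import numFieldNormedType.Exports.

Local Open Scope classical_set_scope.
Local Open Scope ring_scope.

(** Fix f and put a = (sum_i w_i^2 |P_(W_i) f|^2)^(1/2), b for the same quantity
    with V_i, d for the one with the differences P_(W_i) f - P_(V_i) f, and
    t = |K^* f|. Minkowski's inequality in l^2 ([sqrte_esum_minkowski], whence
    [weighted_square_sum_triangle]) gives b <= a + d and a <= b + d. The
    perturbation hypothesis bounds d by lambda1 a + lambda2 b + mu t, and the
    lower frame bound gives t <= a / sqrt A, so
      (1 - lambda2) b <= (1 + lambda1 + mu / sqrt A) a   and
      (1 - lambda1 - mu / sqrt A) a <= (1 + lambda2) b.
    Dividing, squaring and inserting A t^2 <= a^2 <= B |f|^2 yields both bounds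
    ([perturbed_bounds]). *)

(** The constants are written as in the frame bounds of the perturbed family;
    they equal (1 - l1 - m) / (1 + l2) and (1 + l1 + m) / (1 - l2). *)
Lemma perturbed_bounds (R : realFieldType) (a b d l1 l2 m : R) :
  0 <= b -> 0 <= l2 < 1 -> 0 <= l1 + m < 1 ->
  d <= (l1 + m) * a + l2 * b -> a <= b + d -> b <= a + d ->
  a * (1 - (l1 + l2 + m) / (1 + l2)) <= b <=
    a * (1 + (l1 + l2 + m) / (1 - l2)).
Proof.
move=> b0 /andP[l20 l21] /andP[m0 m1] hd hab hba.
have -> : 1 - (l1 + l2 + m) / (1 + l2) = (1 - (l1 + m)) / (1 + l2).
  by field; lra.
have -> : 1 + (l1 + l2 + m) / (1 - l2) = (1 + (l1 + m)) / (1 - l2).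
  by field; lra.
rewrite !mulrA ler_pdivrMr ?ler_pdivlMr; [|lra|lra].
by apply/andP; split; nra.
Qed.

Section Minkowski.
Variables (R : realType) (T : choiceType) (x y z : T -> R).
Hypotheses (x0 : forall i, 0 <= x i) (y0 : forall i, 0 <= y i).
Hypotheses (z0 : forall i, 0 <= z i) (zxy : forall i, z i <= x i + y i).

(* Weighted Young inequality: the right side exceeds (x + y)^2 by
   (b x - a y)^2 / (a b). *)
Let sqr_young (a b : R) i : 0 < a -> 0 < b ->
  z i ^+ 2 <= (1 + b / a) * x i ^+ 2 + (1 + a / b) * y i ^+ 2.
Proof.
move=> a0 b0; apply: (@le_trans _ _ ((x i + y i) ^+ 2)).
  by rewrite lerXn2r // nnegrE ?addr_ge0.
rewrite -subr_ge0.
have -> : (1 + b / a) * x i ^+ 2 + (1 + a / b) * y i ^+ 2 - (x i + y i) ^+ 2 =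
   (b * x i - a * y i) ^+ 2 / (a * b) by field; rewrite !lt0r_neq0.
by rewrite divr_ge0 ?sqr_ge0 // mulr_ge0 ?ltW.
Qed.

(** With the weights 1 + b / a and 1 + a / b the Young inequality sums to
    exactly (a + b)^2. *)
Lemma esum_sqr_le (a b : R) : 0 < a -> 0 < b ->
  (\esum_(i in [set: T]) (x i ^+ 2)%:E <= (a ^+ 2)%:E)%E ->
  (\esum_(i in [set: T]) (y i ^+ 2)%:E <= (b ^+ 2)%:E)%E ->
  (\esum_(i in [set: T]) (z i ^+ 2)%:E <= ((a + b) ^+ 2)%:E)%E.
Proof.
move=> a0 b0 hx hy; apply: ge_ereal_sup => _ [F FT <-].
have [finF _] := FT.
have hx' : \sum_(i \in F) x i ^+ 2 <= a ^+ 2.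
  rewrite -lee_fin -fsumEFin //; apply: le_trans hx.
  by apply: ereal_sup_ubound; exists F.
have hy' : \sum_(i \in F) y i ^+ 2 <= b ^+ 2.
  rewrite -lee_fin -fsumEFin //; apply: le_trans hy.
  by apply: ereal_sup_ubound; exists F.
rewrite fsumEFin // lee_fin.
move: hx' hy'; rewrite !fsbig_finite //= => hx' hy'.
set s := finmap.enum_fset _ in hx' hy' *.
apply: (@le_trans _ _ ((1 + b / a) * (\sum_(i <- s) x i ^+ 2) +
                       (1 + a / b) * (\sum_(i <- s) y i ^+ 2))).
  by rewrite !mulr_sumr -big_split; apply: ler_sum => i _; exact: sqr_young.
have -> : (a + b) ^+ 2 = (1 + b / a) * a ^+ 2 + (1 + a / b) * b ^+ 2.
  by field; rewrite !lt0r_neq0.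
by apply: lerD; rewrite ler_wpM2l // addr_ge0 // divr_ge0 // ltW.
Qed.

Let sqrte_approx (S : \bar R) (e : R) : (0 <= S)%E -> 0 < e ->
  sqrte S = +oo%E \/ exists a : R, [/\ sqrte S = a%:E, 0 <= a &
    (S <= ((a + e) ^+ 2)%:E)%E].
Proof.
case: S => [s||] //=; last by left.
rewrite lee_fin => s0 e0; right; exists (Num.sqrt s); split => //.
rewrite lee_fin -{1}(sqr_sqrtr s0) lerXn2r // ?nnegrE ?sqrtr_ge0 //.
  by rewrite addr_ge0 ?sqrtr_ge0 ?ltW.
by rewrite lerDl ltW.
Qed.

Lemma sqrte_esum_minkowski :
  (sqrte (\esum_(i in [set: T]) (z i ^+ 2)%:E) <=
   sqrte (\esum_(i in [set: T]) (x i ^+ 2)%:E) +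
   sqrte (\esum_(i in [set: T]) (y i ^+ 2)%:E))%E.
Proof.
have S0 (u : T -> R) : (0 <= \esum_(i in [set: T]) (u i ^+ 2)%:E)%E.
  by apply: esum_ge0 => i _; rewrite lee_fin sqr_ge0.
(* The slack e keeps a and b positive in esum_sqr_le. *)
apply/lee_addgt0Pr => e e0; have e20 : 0 < e / 2 by rewrite divr_gt0.
have [->|[a [-> a0 hx]]] := sqrte_approx (S0 x) e20.
  by rewrite addye ?addye ?leey // gt_eqF // (lt_le_trans _ (sqrte_ge0 _)).
have [->|[b [-> b0 hy]]] := sqrte_approx (S0 y) e20.
  by rewrite addey // addye // leey.
have ae : 0 < a + e / 2 by lra.
have be : 0 < b + e / 2 by lra.
have := esum_sqr_le ae be hx hy.
rewrite -[X in (X <= _)%E -> _](sqr_sqrte (S0 z)).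
have -> : (a%:E + b%:E + e%:E)%E = (a + e / 2 + (b + e / 2))%:E.
  by rewrite -!EFinD; congr EFin; field.
by rewrite EFin_expe; apply: lee_sqrE; rewrite lee_fin addr_ge0 // ltW.
Qed.

End Minkowski.

Section Norm.
Variables (R : realType) (k : scalar_kind).
Variable H : completeNormedModType (scalar_field R k).

Lemma re_scalarD (s t : scalar_field R k) :
  re_scalar (s + t) = re_scalar s + re_scalar t.
Proof. by case: k s t => //= -[? ?] [? ?]. Qed.

Lemma re_scalar_le (s t : scalar_field R k) :
  s <= t -> re_scalar s <= re_scalar t.
Proof. by case: k s t => //= s t; rewrite lecE => /andP[]. Qed.

Lemma rnorm_ge0 (u : H) : 0 <= rnorm u.
Proof.
have := re_scalar_le (normr_ge0 u); rewrite /rnorm.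
by apply: le_trans; case: k.
Qed.

Lemma rnormN (u : H) : rnorm (- u) = rnorm u.
Proof. by rewrite /rnorm normrN. Qed.

Lemma ler_rnormD (u v : H) : rnorm (u + v) <= rnorm u + rnorm v.
Proof. by rewrite /rnorm -re_scalarD; exact: re_scalar_le (ler_normD _ _). Qed.

Variables (I : countType) (w : I -> R).
Hypothesis w0 : forall i, 0 < w i.

Lemma weighted_square_sum_ge0 (u : I -> H) : (0 <= weighted_square_sum w u)%E.
Proof. by apply: esum_ge0 => i _; rewrite lee_fin mulr_ge0 ?sqr_ge0. Qed.

Lemma weighted_square_sum_triangle (u v x : I -> H) :
  (forall i, rnorm (x i) <= rnorm (u i) + rnorm (v i)) ->
  (sqrte (weighted_square_sum w x) <=
   sqrte (weighted_square_sum w u) + sqrte (weighted_square_sum w v))%E.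
Proof.
move=> xuv; have E (a : I -> H) : weighted_square_sum w a =
    (\esum_(i in [set: I]) ((w i * rnorm (a i)) ^+ 2)%:E)%E.
  by apply: eq_esum => i _; rewrite exprMn.
have p (a : I -> H) i : 0 <= w i * rnorm (a i).
  by rewrite mulr_ge0 ?rnorm_ge0 // ltW.
rewrite !E; apply: sqrte_esum_minkowski => // i.
by rewrite -mulrDr ler_wpM2l // ltW.
Qed.

End Norm.

(* The hypothesis hV says that the series on the right of hpert converges, so
   that hpert is an inequality between real numbers; with +oo <= +oo allowed
   the conclusion is false. *)
Theorem theorem10 (R : realType) (k : scalar_kind)
    (H : completeNormedModType (scalar_field R k))
    (dot : {dot H for conj_scalar R k})
    (hdot : inner_product_of_norm dot)
    (hsep : separable_space H)
    (I : countType)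
    (K : {linear H -> H}) (hK : bounded_operator K)
    (W : I -> set H) (w : I -> R) (A B : R)
    (hW : K_fusion_frame dot K W w A B)
    (V : I -> set H) (hVclosed : forall i, closed_subspace (V i))
    (lambda1 lambda2 mu : R)
    (hlambda1 : 0 <= lambda1) (hlambda2 : 0 <= lambda2) (hmu : 0 <= mu)
    (hmax : Num.max (lambda1 + mu / Num.sqrt A) lambda2 < 1)
    (hV : forall f : H,
      (weighted_square_sum w
         (fun i => orthogonal_projection dot (V i) f) < +oo)%E)
    (hpert : forall f : H,
      (sqrte (weighted_square_sum w
                (fun i => orthogonal_projection dot (W i) f -
                          orthogonal_projection dot (V i) f)%R)
       <= lambda1%:E *
            sqrte (weighted_square_sum w
                     (fun i => orthogonal_projection dot (W i) f))
        + lambda2%:E *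
            sqrte (weighted_square_sum w
                     (fun i => orthogonal_projection dot (V i) f))
        + (mu * rnorm (adjoint dot K f))%:E)%E) :
  K_fusion_frame dot K V w
    (A * (1 - (lambda1 + lambda2 + mu / Num.sqrt A) / (1 + lambda2)) ^+ 2)
    (B * (1 + (lambda1 + lambda2 + mu / Num.sqrt A) / (1 - lambda2)) ^+ 2).
Proof.
have [_ w0 /andP[A0 AB] frameW] := hW.
move: hmax; rewrite gt_max => /andP[hm hl2].
have sA0 : 0 < Num.sqrt A by rewrite sqrtr_gt0.
set m := mu / Num.sqrt A in hm *.
have m0 : 0 <= m by rewrite divr_ge0 // ltW.
have l2 : 0 <= lambda2 < 1 by rewrite hlambda2.
have l1m : 0 <= lambda1 + m < 1 by rewrite addr_ge0.
(* The case a = b = 1, d = 0 compares the two constants. *)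
have /andP[le1 ge1] : 1 * (1 - (lambda1 + lambda2 + m) / (1 + lambda2)) <= 1 <=
    1 * (1 + (lambda1 + lambda2 + m) / (1 - lambda2)).
  by apply: (@perturbed_bounds _ 1 1 0) => //; lra.
have cl0 : 0 < 1 - (lambda1 + lambda2 + m) / (1 + lambda2).
  by rewrite subr_gt0 ltr_pdivrMr; lra.
move: le1 ge1; rewrite !mul1r.
set cl := 1 - _ in cl0 *; set cu := 1 + _ => le1 ge1.
split => //.
- rewrite mulr_gt0 ?exprn_gt0 //=.
  apply: ler_pM => //; [exact: ltW|exact: sqr_ge0|].
  by apply: lerXn2r; rewrite ?nnegrE; lra.
move=> f /=; have [] := frameW f; have := hpert f; have := hV f.
set PW := fun i => orthogonal_projection dot (W i) f.
set PV := fun i => orthogonal_projection dot (V i) f.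
set PD := fun i => _ - _.
have triWVD : (sqrte (weighted_square_sum w PW) <=
    sqrte (weighted_square_sum w PV) + sqrte (weighted_square_sum w PD))%E.
  apply: weighted_square_sum_triangle => // i.
  by rewrite -[PW i](subrKC (PV i)) ler_rnormD.
have triVWD : (sqrte (weighted_square_sum w PV) <=
    sqrte (weighted_square_sum w PW) + sqrte (weighted_square_sum w PD))%E.
  apply: weighted_square_sum_triangle => // i.
  by rewrite -(rnormN (PD i)) opprB -[PV i](subrKC (PW i)) ler_rnormD.
have := weighted_square_sum_ge0 w PD.
have := weighted_square_sum_ge0 w PV.
have := weighted_square_sum_ge0 w PW.
move: triWVD triVWD.
(* The sum for W is finite by the upper frame bound, the one for V by hV, and
   the one for the differences because the right side of hpert is finite. *)
case: (weighted_square_sum w PW) => [sW||] //;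
  case: (weighted_square_sum w PV) => [sV||] //;
  case: (weighted_square_sum w PD) => [sD||] //=.
rewrite -!EFinM -!EFinD !lee_fin.
set a := Num.sqrt sW; set b := Num.sqrt sV; set d := Num.sqrt sD.
move=> hab hba sW0 sV0 sD0 _ hd hA hB.
have a0 : 0 <= a := sqrtr_ge0 _.
have b0 : 0 <= b := sqrtr_ge0 _.
have t0 := rnorm_ge0 (adjoint dot K f).
rewrite -(sqr_sqrtr sW0) -/a in hA hB; rewrite -(sqr_sqrtr sV0) -/b.
have hta : mu * rnorm (adjoint dot K f) <= m * a.
  rewrite /m mulrAC ler_pdivlMr // -mulrA ler_wpM2l //.
  rewrite -(@ler_pXn2r _ 2) ?nnegrE ?mulr_ge0 ?(ltW sA0) //.
  by rewrite exprMn (sqr_sqrtr (ltW A0)) mulrC.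
have hdm : d <= (lambda1 + m) * a + lambda2 * b by lra.
have /andP[lo up] := perturbed_bounds b0 l2 l1m hdm hab hba.
split.
- rewrite mulrAC; apply: (@le_trans _ _ ((a * cl) ^+ 2)).
    by rewrite exprMn ler_wpM2r ?sqr_ge0.
  by rewrite lerXn2r // nnegrE mulr_ge0 // ltW.
- rewrite mulrAC; apply: (@le_trans _ _ ((a * cu) ^+ 2)).
    by rewrite lerXn2r // nnegrE mulr_ge0 // (le_trans ler01).
  by rewrite exprMn ler_wpM2r ?sqr_ge0.
Qed.
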